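(* Every tree of oriented cycles is a $\mathcal{Q}^N$ quiver (for some $N\ge1$).
   Context: Quivers are finite connected directed graphs without loops or 2-cycles. A quiver is irreducible if each of its arrows lies in some oriented cycle. Trees of oriented cycles. An irreducible quiver $Q$ is a tree of oriented cycles if it is obtained by gluing together (by identifying vertices) a finite number $m$ of oriented cycles $\{S_i\mid i=1,\dots,m\}$, each of length at least $3$, such that each oriented $k$-cycle shares a vertex with at most $k$ other oriented cycles and the number of cycles in the underlying graph of $Q$ is $m$. In such a quiver each vertex appears in at most two cycles, and every cycle in $Q$ is an oriented cycle. $\mathcal{Q}^N$ quivers. For $N\ge1$, a quiver $Q^N$ is a finite connected quiver with vertex set $\{v^i_\ell\mid 1\le i\le N,\ 1\le \ell\le k_i\}$ (with $k_i\ge1$) whose arrows are exactly: (1) the vertical arrows $v^i_1\leftarrow v^i_2\leftarrow\cdots\leftarrow v^i_{k_i}$ for $i=1,\dots,N$ (the $i$-th vertical chain); (2) oblique arrows: for two distinct chains, the arrows between them (if there are any) form exactly one path $v^i_{a_1}\to v^j_{b_1}\to v^i_{a_2}\to v^j_{b_2}\to v^i_{a_3}\to\cdots$ (starting in one of the two chains, called chain $i$, and ending in either), with $1\le a_1<a_2<\cdots\le k_i$ and $1\le b_1<b_2<\cdots\le k_j$; (3) if $3\le m\le N$, $i_1,\dots,i_m$ are pairwise distinct and there is an arrow (in either direction) between the chains $i_r$ and $i_{r+1}$ for each $r=1,\dots,m-1$, then there is no arrow between the chains $i_1$ and $i_m$. A quiver is called a $\mathcal{Q}^N$ quiver if its vertices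 can be labelled so that it has this form for some $N\ge 1$. *)

(* Defs.v *)
From mathcomp Require Import all_boot.
Set Implicit Arguments.
Unset Strict Implicit.
Unset Printing Implicit Defensive.

(* Finite directed multigraph, so that gluing cycles along vertices never
   merges arrows: parallel arrows are kept apart, and two of them count as a
   cycle of length 2 of the underlying graph. *)
Record digraph := Digraph {
  vert : finType;
  arrow : finType;
  src : arrow -> vert;
  tgt : arrow -> vert
}.

Section Digraphs.
Variable Q : digraph.

Definition arrows_between (x y : vert Q) : {set arrow Q} :=
  [set a | (src a == x) && (tgt a == y)].

Definition adjacent : rel (vert Q) :=
  fun x y => (arrows_between x y != set0) || (arrows_between y x != set0).

Definition connected_digraph : Prop :=
  0 < #|vert Q| /\ forall x y : vert Q, connect adjacent x y.

Definition is_quiver : Prop :=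
  [/\ connected_digraph,
      forall a : arrow Q, src a != tgt a
    & forall a b : arrow Q, ~~ ((tgt a == src b) && (tgt b == src a))].

(* Cycles, oriented or not, are regarded as subgraphs and therefore represented
   by their sets of arrows: neither the starting point nor the direction of
   traversal matters when counting them. *)

Definition oriented_cycle (C : {set arrow Q}) : bool :=
  (C != set0) &&
  [exists s : #|C|.-tuple (arrow Q),
    [&& cycle (fun a b => tgt a == src b) s,
        uniq (map (@src Q) s)
      & C == [set a in (s : seq (arrow Q))]]].

(* A step is an arrow with a direction of traversal: [(a, true)] goes along
   [a], [(a, false)] goes against it. *)
Definition step : finType := (arrow Q * bool)%type.
Definition step_from (d : step) : vert Q := if d.2 then src d.1 else tgt d.1.
Definition step_to (d : step) : vert Q := if d.2 then tgt d.1 else src d.1.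

Definition underlying_cycle (C : {set arrow Q}) : bool :=
  (C != set0) &&
  [exists s : #|C|.-tuple step,
    [&& cycle (fun d e => step_to d == step_from e) s,
        uniq (map step_from s),
        uniq (map fst s)
      & C == [set a in map fst s]]].

Definition vertices_of (C : {set arrow Q}) : {set vert Q} :=
  (@src Q @: C) :|: (@tgt Q @: C).

Definition irreducible : Prop :=
  forall a : arrow Q, exists2 C, oriented_cycle C & a \in C.

(* [Q] is a quotient of the disjoint union of oriented cycles of lengths
   [len i]: the pairs [(i, j)] index both the vertices of this disjoint union
   and its arrows, the arrow [(i, j)] going from vertex [(i, j)] to vertex
   [(i, j + 1 mod len i)].  Vertices may be identified by [p], arrows not. *)
Definition glued_from (m : nat) (len : 'I_m -> nat) : Prop :=
  exists (p : {i : 'I_m & 'I_(len i)} -> vert Q)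
         (q : {i : 'I_m & 'I_(len i)} -> arrow Q),
    [/\ forall x : vert Q, exists d, p d = x,
        bijective q
      & forall (i : 'I_m) (j : 'I_(len i)),
          src (q (existT _ i j)) = p (existT _ i j) /\
          tgt (q (existT _ i j)) = p (existT _ i (ordS j))].

Definition tree_of_oriented_cycles : Prop :=
  is_quiver /\ irreducible /\
  exists (m : nat) (len : 'I_m -> nat),
    [/\ forall i, 3 <= len i,
        glued_from len,
        forall C, oriented_cycle C ->
          #|[set C' | [&& oriented_cycle C', C' != C
                        & ~~ [disjoint vertices_of C & vertices_of C']]]|
            <= #|C|
      & #|[set C | underlying_cycle C]| = m].

(* In a labelling [v] by [N] vertical chains of lengths [k i], chains and
   levels are numbered from 0. *)
Section Labelling.
Variables (N : nat) (k : 'I_N -> nat).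
Variable v : {i : 'I_N & 'I_(k i)} -> vert Q.

Definition narrows (i : 'I_N) (x : 'I_(k i)) (j : 'I_N) (y : 'I_(k j)) : nat :=
  #|arrows_between (v (existT _ i x)) (v (existT _ j y))|.

Definition vertical_arrows : Prop :=
  forall (i : 'I_N) (x y : 'I_(k i)), narrows x y = (x == y.+1 :> nat).

(* The arrows between chains [i] and [j] are those of the path
   i:a_1 -> j:b_1 -> i:a_2 -> j:b_2 -> ..., which ends in either chain.
   When there are none, [a] and [b] are empty. *)
Definition oblique_path (i j : 'I_N) : Prop :=
  exists (a : seq 'I_(k i)) (b : seq 'I_(k j)),
    [/\ sorted (fun x x' : 'I_(k i) => x < x') a,
        sorted (fun y y' : 'I_(k j) => y < y') b,
        size b <= size a <= (size b).+1,
        forall x y, narrows x y = ((x, y) \in zip a b)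
      & forall y x, narrows y x = ((y, x) \in zip b (behead a))].

Definition linked : rel 'I_N :=
  fun i j => [exists x : 'I_(k i), exists y : 'I_(k j),
                adjacent (v (existT _ i x)) (v (existT _ j y))].

Definition QN_labelling : Prop :=
  [/\ forall i, 1 <= k i,
      bijective v,
      vertical_arrows,
      forall i j, i != j -> oblique_path i j \/ oblique_path j i
    & forall (i : 'I_N) (s : seq 'I_N),
        3 <= size (i :: s) -> uniq (i :: s) -> path linked i s ->
        ~~ linked i (last i s)].

End Labelling.

Definition QN_quiver (N : nat) : Prop :=
  is_quiver /\
  exists (k : 'I_N -> nat) (v : {i : 'I_N & 'I_(k i)} -> vert Q),
    QN_labelling v.

End Digraphs.

(* Main.v *)
Require Import Defs.
From mathcomp Require Import all_boot.
From mathcomp Require Import zify.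

Set Implicit Arguments.
Unset Strict Implicit.
Unset Printing Implicit Defensive.

(** The glued cycles are [m] closed trails with pairwise disjoint sets of
    arrows.  Each closed trail contains a cycle ([arc_contains_cycle]), so if
    [Q] has only [m] underlying cycles, then each trail contains exactly one
    and every underlying cycle lies inside a single trail
    ([underlying_cycle_single_trail]).  A trail passing twice through a vertex
    would contain two arrow-disjoint cycles, hence the trails are simple cycles
    ([trail_vert_inj]).

    Fix any vertex [r].  By connectivity the cycles can be listed so that each
    one meets [r] or a cycle before it in the list.  It meets the union of [r]
    and the previous cycles in one vertex only ([trail_meets_once]): otherwise
    an arc of the new cycle and a simple path in that union would close up to
    an underlying cycle using arrows of two trails.  So [Q] is a tree of cycles
    rooted at [r], and each cycle has a well-defined attaching vertex.

    The chains are then [{r}] and, for each cycle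
    [x -> y_1 -> ... -> y_(l-1) -> x] attached at [x], the directed path
    [y_1 -> ... -> y_(l-1)], with [y_(l-1)] at level 0.  The two arrows at [x]
    form the oblique path [y_(l-1) -> x -> y_1] between this chain and the one
    that contains [x]; its levels in the former increase strictly because
    [l >= 3].  Linked chains are thus a child and its parent in a tree, which
    has no cycle, and this is condition (3)
    ([chain_tree_QN_labelling], [rooted_trails_QN_labelling]). *)

(** * Walks and simple paths *)

Definition consecutive Q : rel (step Q) := fun d e => step_to d == step_from e.

(** The vertices that [s] visits from [x] to [y] are listed in two ways, so
    that concatenation of walks is rewriting and the empty walk has [x = y]. *)
Definition walk Q (x : vert Q) (s : seq (step Q)) (y : vert Q) :=
  x :: map (@step_to Q) s = rcons (map (@step_from Q) s) y.

Lemma walk_cat Q (x y z : vert Q) s1 s2 :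
  walk x s1 y -> walk y s2 z -> walk x (s1 ++ s2) z.
Proof.
rewrite /walk !map_cat => w1 w2.
by rewrite rcons_cat -w2 -cat_rcons -w1.
Qed.

Lemma closed_walk_cycle Q (x : vert Q) s : walk x s x -> cycle (@consecutive Q) s.
Proof.
have chain e d t : step_to e :: map (@step_to Q) t =
    rcons (map (@step_from Q) t) (step_from d) ->
    path (@consecutive Q) e (rcons t d).
  elim: t e => [|f t IHt] e /= [e_f]; rewrite /consecutive e_f eqxx //.
  by move=> eq_t; rewrite /=; apply: IHt.
by case: s => // d s [-> eq_s]; apply: chain.
Qed.

Lemma underlying_cycle_of_steps Q (s : seq (step Q)) :
  s != [::] -> cycle (@consecutive Q) s -> uniq (map (@step_from Q) s) ->
  uniq (map fst s) -> underlying_cycle [set a in map fst s].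
Proof.
move=> s_n0 cyc_s uniq_v uniq_a.
have size_s : size s == #|[set a in map fst s]|.
  by rewrite cardsE (card_uniqP uniq_a) size_map.
apply/andP; split.
  case: s s_n0 {cyc_s uniq_v uniq_a size_s} => // d s _.
  by apply/set0Pn; exists d.1; rewrite inE mem_head.
by apply/existsP; exists (Tuple size_s); apply/and4P; split.
Qed.

Lemma underlying_cycle_of_walk Q (s : seq (arrow Q)) :
  s != [::] -> cycle (fun a b => tgt a == src b) s -> uniq (map (@src Q) s) ->
  underlying_cycle [set a in s].
Proof.
move=> s_n0 cyc_s uniq_v.
have fstK : map fst [seq (a, true) : step Q | a <- s] = s.
  by rewrite -map_comp map_id.
rewrite -{}[X in [set a in X]]fstK; apply: underlying_cycle_of_steps.
- by case: (s) s_n0.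
- by rewrite cycle_map.
- by rewrite -map_comp.
- by rewrite -map_comp map_id (map_uniq uniq_v).
Qed.

Section SimplePaths.
Variables (Q : digraph) (U : {set arrow Q}).

Definition joined : rel (vert Q) := fun x y =>
  [exists d : step Q, [&& d.1 \in U, step_from d == x & step_to d == y]].

Lemma joined_sym : symmetric joined.
Proof.
have rev x y : joined x y -> joined y x.
  case/existsP=> -[a o] /and3P[/= aU /eqP <- /eqP <-].
  apply/existsP; exists (a, ~~ o); rewrite /= aU.
  by case: o; rewrite /step_from /step_to /= !eqxx.
by move=> x y; apply/idP/idP; apply: rev.
Qed.

(** The steps chosen along a path with distinct vertices use distinct arrows:
    a repeated arrow would have the first vertex of the path as an endpoint
    again later on. *)
Lemma steps_of_path x p :
  path joined x p -> uniq (x :: p) ->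
  exists s : seq (step Q),
    [/\ walk x s (last x p), map (@step_from Q) s = belast x p,
        {subset map fst s <= U} & uniq (map fst s)].
Proof.
elim: p x => [|y p IHp] x /=; first by exists [::].
case/andP=> /existsP[d /and3P[dU /eqP dx /eqP dy]] pth /andP[x_p uniq_p].
have [s [ws from_s sU uniq_s]] := IHp _ pth uniq_p.
exists (d :: s); split=> /=.
- by apply: (@walk_cat _ _ y _ [:: d]) => //; rewrite /walk /= dx dy.
- by rewrite from_s dx.
- by move=> a; rewrite inE => /predU1P[-> | /sU].
rewrite uniq_s andbT; apply: contra x_p => /mapP[e e_s eq_de].
have verts z : z \in map (@step_from Q) s ++ map (@step_to Q) s -> z \in y :: p.
  rewrite mem_cat => /orP[|z_to].
    by rewrite from_s; apply: mem_belast.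
  by rewrite lastI -from_s -ws inE z_to orbT.
apply: verts; rewrite mem_cat.
have: (x == step_from e) || (x == step_to e).
  rewrite -dx /step_from /step_to eq_de.
  by case: d.2; case: e.2; rewrite eqxx ?orbT.
by case/orP=> /eqP ->; rewrite map_f ?orbT.
Qed.
End SimplePaths.

(** * Trees of vertical chains *)

Section ChainTree.
Variables (Q : digraph) (N : nat) (k : 'I_N -> nat).
Variable v : {i : 'I_N & 'I_(k i)} -> vert Q.
Variables (root : 'I_N) (par : 'I_N -> 'I_N) (lev rank : 'I_N -> nat).

(** Each chain other than [root] comes from a cycle with its attaching vertex,
    at level [lev] of the parent chain, removed: the cycle enters the chain at
    its top and leaves it at its bottom. *)
Definition chain_arrow (c : 'I_N) (x : nat) (d : 'I_N) (y : nat) : bool :=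
  [|| (c == d) && (x == y.+1),
      [&& d != root, c == par d, x == lev d & y == (k d).-1]
    | [&& c != root, d == par c, y == lev c & x == 0]].

Hypothesis k_gt0 : forall c, 0 < k c.
Hypothesis rank_par : forall c, c != root -> rank (par c) < rank c.
Hypothesis lev_lt : forall c, c != root -> lev c < k (par c).
Hypothesis k_gt1 : forall c, c != root -> 1 < k c.
Hypothesis narrowsE : forall c (x : 'I_(k c)) d (y : 'I_(k d)),
  narrows v x y = chain_arrow c x d y.

Let par_neq c : c != root -> par c != c.
Proof. by move/rank_par; apply: contraTneq => ->; rewrite ltnn. Qed.

Lemma linked_par c d : c != d -> linked v c d ->
  (d != root) && (c == par d) || (c != root) && (d == par c).
Proof.
move=> c_d /existsP[x /existsP[y]]; rewrite /adjacent -!cards_eq0.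
rewrite -!/(narrows _ _ _) !narrowsE /chain_arrow (eq_sym d c) (negPf c_d) /=.
by do !case: eqP => //=.
Qed.

(** The path goes from the bottom of [c] to the attaching vertex and back to the
    top of [c]; its levels in [c] increase because [c] has two vertices at least. *)
Lemma oblique_path_to_par c : c != root -> oblique_path v c (par c).
Proof.
move=> c_root; have c_par := par_neq c_root.
have k_c := k_gt1 c_root.
have lt0 : 0 < k c := ltnW k_c.
have ltk : (k c).-1 < k c by rewrite prednK.
have no_par : (par c != root) && (c == par (par c)) = false.
  apply/negP=> /andP[/rank_par p_root /eqP cE].
  by have := rank_par c_root; rewrite {2}cE; lia.
exists [:: Ordinal lt0; Ordinal ltk], [:: Ordinal (lev_lt c_root)].
split=> //=.
- by rewrite andbT -ltnS prednK.
- move=> x y; rewrite narrowsE /chain_arrow eq_sym (negPf c_par) c_root eqxx /=.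
  by rewrite inE xpair_eqE -!val_eqE /= andbA no_par /= andbC.
- move=> y x; rewrite narrowsE /chain_arrow (negPf c_par) c_root eqxx /=.
  rewrite inE xpair_eqE -!val_eqE /= [_ && [&& c == _, _ & _]]andbA.
  by rewrite no_par orbF.
Qed.

(** In a cyclic sequence of distinct chains, each linked to the next, both
    neighbours of a chain of maximal rank must be its parent, so they coincide
    and there are at most two chains. *)
Lemma chain_tree_QN_labelling : bijective v -> QN_labelling v.
Proof.
move=> bij_v; split=> //.
- by move=> c x y; rewrite narrowsE /chain_arrow eqxx;
     congr nat_of_bool; case: eqP => //= _; apply/norP; split;
     apply/negP=> /and3P[/par_neq/negPf]; rewrite eq_sym => ->.
- move=> c d c_d.
  have [/andP[d_root /eqP ->]|not_cd] := boolP ((d != root) && (c == par d)).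
    by right; apply: oblique_path_to_par.
  have [/andP[c_root /eqP ->]|not_dc] := boolP ((c != root) && (d == par c)).
    by left; apply: oblique_path_to_par.
  left; exists [::], [::]; split=> //= x y; rewrite narrowsE /chain_arrow.
    by rewrite (negPf c_d) !andbA -!(andbA (_ && _)) (negPf not_cd) (negPf not_dc).
  rewrite eq_sym (negPf c_d) !andbA -!(andbA (_ && _)).
  by rewrite (negPf not_cd) (negPf not_dc).
move=> c s size_s uniq_s path_s; apply/negP=> closed.
have cyc : cycle (linked v) (c :: s).
  rewrite /= rcons_path path_s /=.
  case/existsP: closed => x /existsP[y adj_xy].
  by apply/existsP; exists y; apply/existsP; exists x; rewrite /adjacent orbC.
(* A chain [d] of maximal rank on the cycle; rotate the cycle to start there. *)
case: (@arg_maxnP _ c (mem (c :: s)) rank (mem_head _ _)) => d d_s max_d.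
have [n s' rot_s] := rot_to d_s.
have uniq_d : uniq (d :: s') by rewrite -rot_s rot_uniq.
have cyc_d : cycle (linked v) (d :: s') by rewrite -rot_s rot_cycle.
have size_d : 2 < size (d :: s') by rewrite -rot_s size_rot.
have nbr e : e \in s' -> linked v d e || linked v e d -> e = par d.
  move=> e_s' link_de.
  have d_e : d != e by apply: contraTneq uniq_d => ->; rewrite /= e_s'.
  have: (e != root) && (d == par e) || (d != root) && (e == par d).
    by case/orP: link_de => /linked_par; [|rewrite orbC eq_sym]; apply.
  case/orP=> /andP[/rank_par lt_r /eqP] => [dE|//].
  have: rank e <= rank d.
    by apply: max_d; rewrite -[_ e]/(e \in c :: s) -(mem_rot n) rot_s inE e_s' orbT.
  by rewrite leqNgt dE lt_r.
case: s' uniq_d cyc_d size_d nbr {rot_s} => // e; case/lastP=> // s' f.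
rewrite /= -rcons_cons rcons_path last_rcons.
move=> /andP[_ /andP[e_f _]] /and3P[link_de _ link_fd] _ nbr.
have eE := nbr e (mem_head _ _).
have fE : f = par d.
  by apply: nbr; rewrite ?link_fd ?orbT // inE mem_rcons mem_head orbT.
by move: e_f; rewrite eE ?link_de // fE mem_rcons mem_head.
Qed.
End ChainTree.

(** * Families of closed trails *)

(** The closed trails of a gluing, with positions in [nat] read modulo the
    length, so that arcs may run over the starting point of a trail and moving
    this starting point is a translation.  Vertices may still be repeated, on
    one trail or on several ones, but arrows may not. *)
Record trail_family Q (m : nat) (L : 'I_m -> nat)
    (P : 'I_m -> nat -> vert Q) (A : 'I_m -> nat -> arrow Q) : Prop := TrailFamily {
  trail_gt2 : forall i, 2 < L i;
  trail_vert_mod : forall i t, P i (t %% L i) = P i t;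
  trail_arrow_mod : forall i t, A i (t %% L i) = A i t;
  trail_src : forall i t, src (A i t) = P i t;
  trail_tgt : forall i t, tgt (A i t) = P i t.+1;
  trail_arrow_inj : forall i s j t, A i s = A j t -> i = j /\ s = t %[mod L i];
  trail_arrow_onto : forall a, exists i t, a = A i t;
  trail_vert_onto : forall x, exists i t, x = P i t
}.

Lemma trail_family_of_gluing Q m (len : 'I_m -> nat) :
  (forall i, 2 < len i) -> glued_from Q len ->
  exists (P : 'I_m -> nat -> vert Q) (A : 'I_m -> nat -> arrow Q),
    trail_family len P A.
Proof.
move=> len_gt2 [p [q [p_onto [q' qK q'K] pq]]].
have len_gt0 i : 0 < len i by apply: leq_trans (len_gt2 i).
pose pos i t : 'I_(len i) := Ordinal (ltn_pmod t (len_gt0 i)).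
have pos_mod i t : pos i (t %% len i) = pos i t.
  by apply: val_inj; rewrite /= modn_mod.
have posK i (j : 'I_(len i)) : pos i j = j.
  by apply: val_inj; rewrite /= modn_small.
have ordS_pos i t : ordS (pos i t) = pos i t.+1.
  by apply: val_inj; rewrite /= -addn1 modnDml addn1.
exists (fun i t => p (existT _ i (pos i t))), (fun i t => q (existT _ i (pos i t))).
split=> //.
- by move=> i t; rewrite pos_mod.
- by move=> i t; rewrite pos_mod.
- by move=> i t; have [-> _] := pq i (pos i t).
- by move=> i t; have [_ ->] := pq i (pos i t); rewrite ordS_pos.
- move=> i s j t /(can_inj qK) eq_ij.
  have ij : i = j := congr1 tag eq_ij.
  split=> //; case: j / ij eq_ij => eq_st.
  have := @eq_from_Tagged _ (fun i => 'I_(len i)) i (pos i s) (pos i t) eq_st.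
  by case.
- move=> a; case: (q' a) (q'K a) => i j qa.
  by exists i, (val j); rewrite posK.
move=> x; have [[i j] px] := p_onto x.
by exists i, (val j); rewrite posK.
Qed.

(** This serves to make position 0 of each trail its attaching vertex. *)
Lemma trail_family_rotate Q m (L : 'I_m -> nat) P A (r : 'I_m -> nat) :
  @trail_family Q m L P A ->
  trail_family L (fun i t => P i (r i + t)) (fun i t => A i (r i + t)).
Proof.
case=> L_gt2 Pmod Amod srcA tgtA Ainj Aonto Ponto.
have unrot i t : r i + (t + (L i * r i - r i)) = t %[mod L i].
  rewrite addnCA subnKC; first by rewrite addnC mulnC modnMDl.
  by rewrite leq_pmull // (leq_trans _ (L_gt2 i)).
split=> //.
- by move=> i t; rewrite -Pmod modnDmr Pmod.
- by move=> i t; rewrite -Amod modnDmr Amod.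
- by move=> i t; rewrite tgtA addnS.
- by move=> i s j t /Ainj[eq_ij /eqP]; rewrite -eq_ij eqn_modDl => /eqP.
- move=> a; have [i [t ->]] := Aonto a; exists i, (t + (L i * r i - r i)).
  by rewrite -Amod -unrot Amod.
move=> x; have [i [t ->]] := Ponto x; exists i, (t + (L i * r i - r i)).
by rewrite -Pmod -unrot Pmod.
Qed.

Section TrailFamily.
Variables (Q : digraph) (m : nat) (L : 'I_m -> nat).
Variables (P : 'I_m -> nat -> vert Q) (A : 'I_m -> nat -> arrow Q).
Hypothesis trails : trail_family L P A.

Let L_gt0 i : 0 < L i. Proof. exact: leq_trans (trail_gt2 trails i). Qed.

Lemma trail_vertDl i t : P i (t + L i) = P i t.
Proof. by rewrite -(trail_vert_mod trails) modnDr (trail_vert_mod trails). Qed.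

Definition arc i a n : seq (arrow Q) := [seq A i t | t <- iota a n].

Lemma src_arc i a n : map (@src Q) (arc i a n) = [seq P i t | t <- iota a n].
Proof. by rewrite -map_comp; apply: eq_map => t /=; apply: (trail_src trails). Qed.

Lemma arc_cycle i a n :
  P i a = P i (a + n) -> cycle (fun b c => tgt b == src c) (arc i a n).
Proof.
case: n => // n; rewrite addnS /arc /= => closed.
suff step_path b l : P i (b + l).+1 = P i a ->
    path (fun b c => tgt b == src c) (A i b)
      (rcons [seq A i t | t <- iota b.+1 l] (A i a)).
  exact: step_path.
elim: l b => [|l IHl] b /=; rewrite (trail_src trails) (trail_tgt trails).
  by rewrite addn0 => ->; rewrite eqxx.
by move=> closed_b; rewrite eqxx; apply: IHl; rewrite addSnnS.
Qed.

(** If a closed arc repeats a vertex, a strictly shorter closed arc lies between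
    the two occurrences. *)
Lemma arc_contains_cycle i a n : 0 < n -> P i a = P i (a + n) ->
  exists2 C : {set arrow Q}, underlying_cycle C & {subset C <= arc i a n}.
Proof.
have [l] := ubnP n; elim: l a n => // l IHl a n le_n n_gt0 closed.
have [uniq_n|] := boolP (uniq (map (@src Q) (arc i a n))).
  exists [set b in arc i a n]; last by move=> b; rewrite inE.
  apply: underlying_cycle_of_walk (arc_cycle closed) uniq_n.
  by rewrite -size_eq0 size_map size_iota -lt0n.
rewrite src_arc; case/(uniqPn (P i 0)) => s [t [lt_st]].
rewrite size_map size_iota => lt_tn.
rewrite !(nth_map 0) ?size_iota ?(ltn_trans lt_st) //.
rewrite !nth_iota ?(ltn_trans lt_st) //.
move=> eq_st.
have [] := IHl (a + s) (t - s); rewrite ?subn_gt0 //; try lia.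
  by rewrite eq_st; congr P; lia.
move=> C cycC subC; exists C => // b /subC /mapP[u].
by rewrite mem_iota => u_st ->; apply: map_f; rewrite mem_iota; lia.
Qed.

Lemma mem_arcP i a n b : b \in arc i a n -> exists2 t, a <= t < a + n & b = A i t.
Proof. by case/mapP=> t; rewrite mem_iota => t_n ->; exists t. Qed.

Hypothesis count_cycles : #|[set C : {set arrow Q} | underlying_cycle C]| = m.

Lemma underlying_cycle_n0 (C : {set arrow Q}) :
  underlying_cycle C -> exists b, b \in C.
Proof. by case/andP=> /set0Pn. Qed.

(** Choosing one cycle in each trail gives an injection of ['I_m] into the
    underlying cycles, and by counting it is onto. *)
Lemma representative_cycles : exists c : 'I_m -> {set arrow Q},
  (forall i, {subset c i <= arc i 0 (L i)}) /\
  (forall C : {set arrow Q}, underlying_cycle C -> exists i, C = c i).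
Proof.
have exC i : exists C : {set arrow Q},
    underlying_cycle C && (C \subset [set b in arc i 0 (L i)]).
  have [|C cycC subC] := @arc_contains_cycle i 0 (L i) (L_gt0 i).
    by rewrite trail_vertDl.
  by exists C; rewrite cycC; apply/subsetP=> b /subC; rewrite inE.
pose c i := xchoose (exC i).
have c_cyc i : underlying_cycle (c i) by have /andP[] := xchooseP (exC i).
have c_sub i : {subset c i <= arc i 0 (L i)}.
  by have /andP[_ /subsetP sub] := xchooseP (exC i) => b /sub; rewrite inE.
have c_inj : injective c.
  move=> i j eq_c; have [b b_i] := underlying_cycle_n0 (c_cyc i).
  have [t _ b_t] := mem_arcP (c_sub i b b_i).
  rewrite eq_c in b_i; have [u _ b_u] := mem_arcP (c_sub j b b_i).
  by have [] := trail_arrow_inj trails (etrans (esym b_t) b_u).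
exists c; split=> // C cycC.
have imE : c @: 'I_m = [set C : {set arrow Q} | underlying_cycle C].
  apply/eqP; rewrite eqEcard count_cycles card_imset // card_ord leqnn andbT.
  by apply/subsetP=> _ /imsetP[i _ ->]; rewrite inE.
have: C \in c @: 'I_m by rewrite imE inE.
by case/imsetP=> i _ ->; exists i.
Qed.

Lemma underlying_cycle_single_trail (C : {set arrow Q}) i s j t :
  underlying_cycle C -> A i s \in C -> A j t \in C -> i = j.
Proof.
have [c [c_sub c_onto]] := representative_cycles.
case/c_onto=> l -> /c_sub/mem_arcP[u _ eq_i] /c_sub/mem_arcP[w _ eq_j].
have [-> _] := trail_arrow_inj trails eq_i.
by have [-> _] := trail_arrow_inj trails eq_j.
Qed.

(** A repeated vertex splits the trail into two arrow-disjoint closed arcs; the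
    cycles in these two arcs would both be the only cycle of the trail. *)
Lemma trail_vert_inj i s t : P i s = P i t -> s = t %[mod L i].
Proof.
have [c [c_sub c_onto]] := representative_cycles.
rewrite -(trail_vert_mod trails i s) -(trail_vert_mod trails i t).
have := ltn_pmod s (L_gt0 i); have := ltn_pmod t (L_gt0 i).
move: (s %% L i) (t %% L i) => {}s {}t lt_t lt_s eq_st.
wlog lt_st : s t lt_s lt_t eq_st / s < t.
  by move=> hyp; case: (ltngtP s t) => // /hyp ->.
have [] := @arc_contains_cycle i s (t - s).
  by rewrite subn_gt0.
  by rewrite eq_st subnKC // ltnW.
have [] := @arc_contains_cycle i t (L i + s - t); first lia.
  rewrite -eq_st -(trail_vertDl i s); congr P; lia.
move=> C2 cyc2 sub2 C1 cyc1 sub1.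
have eq_c (C : {set arrow Q}) a n : underlying_cycle C ->
    {subset C <= arc i a n} -> C = c i.
  move=> /[dup] /underlying_cycle_n0[b bC] /c_onto[j eqC] subC.
  have [u _ b_u] := mem_arcP (subC _ bC).
  rewrite eqC in bC; have [w _ b_w] := mem_arcP (c_sub _ _ bC).
  by have [-> _] := trail_arrow_inj trails (etrans (esym b_u) b_w).
have [b b1] := underlying_cycle_n0 cyc1.
have b2 : b \in C2 by rewrite (eq_c _ _ _ cyc2 sub2) -(eq_c _ _ _ cyc1 sub1).
have [u u_st b_u] := mem_arcP (sub1 _ b1).
have [w w_st b_w] := mem_arcP (sub2 _ b2).
have [_] := trail_arrow_inj trails (etrans (esym b_u) b_w).
(* The positions [u] in [s, t) and [w] in [t, s + L i) cannot agree modulo [L i]. *)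
have [lt_wL|ge_wL] := ltnP w (L i).
  by rewrite !modn_small; lia.
have <- : (w - L i) %% L i = w %% L i by rewrite -(modnDr (w - L i)) subnK.
rewrite !modn_small; lia.
Qed.

(** Two parallel arrows form an underlying cycle of length 2.  It would lie in a
    single trail, where an arrow is determined by its source. *)
Lemma trail_parallel_eq (a b : arrow Q) :
  src a = src b -> tgt a = tgt b -> a = b.
Proof.
move=> eq_src eq_tgt; apply/eqP/negPn/negP=> a_b.
have loopless : src a != tgt a.
  have [i [t ->]] := trail_arrow_onto trails a.
  rewrite (trail_src trails) (trail_tgt trails); apply/eqP=> /trail_vert_inj/eqP.
  rewrite -addn1 -{1}[t]addn0 eqn_modDl mod0n modn_small //.
  exact: ltnW (trail_gt2 trails i).
have cyc : underlying_cycle [set c in map fst [:: (a, true); (b, false)]].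
  apply: underlying_cycle_of_steps => //=.
  - by rewrite /consecutive /step_to /step_from /= eq_src eq_tgt !eqxx.
  - by rewrite /step_from /= inE -eq_tgt loopless.
  - by rewrite inE a_b.
have [i [s a_is]] := trail_arrow_onto trails a.
have [j [t b_jt]] := trail_arrow_onto trails b.
have ij : i = j.
  by apply: (underlying_cycle_single_trail (s := s) (t := t) cyc);
     rewrite -?a_is -?b_jt !inE eqxx ?orbT.
case/eqP: a_b; move: eq_src; rewrite a_is b_jt -{}ij !(trail_src trails).
move/trail_vert_inj => eq_st.
by rewrite -(trail_arrow_mod trails) eq_st (trail_arrow_mod trails).
Qed.

(** * Attaching the cycles one by one *)

Variable r : vert Q.

Definition trail_arrows (s : seq 'I_m) : {set arrow Q} :=
  [set b | has (fun i => b \in arc i 0 (L i)) s].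

Definition trail_verts (s : seq 'I_m) : seq (vert Q) :=
  r :: flatten [seq [seq P i t | t <- iota 0 (L i)] | i <- s].

Lemma trail_arrowsP s b :
  reflect (exists i t, i \in s /\ b = A i t) (b \in trail_arrows s).
Proof.
rewrite inE; apply: (iffP hasP) => [[i i_s /mem_arcP[t _ ->]]|[i [t [i_s ->]]]].
  by exists i, t.
exists i => //; rewrite -(trail_arrow_mod trails); apply: map_f.
by rewrite mem_iota ltn_mod L_gt0.
Qed.

Lemma trail_vertsP s x :
  reflect (x = r \/ exists i t, i \in s /\ x = P i t) (x \in trail_verts s).
Proof.
rewrite inE; apply: (iffP predU1P) => -[-> | x_s]; try by left.
  by right; case/flatten_mapP: x_s => i i_s /mapP[t _ ->]; exists i, t.
right; case: x_s => i [t [i_s ->]]; apply/flatten_mapP; exists i => //.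
rewrite -(trail_vert_mod trails); apply: map_f.
by rewrite mem_iota ltn_mod L_gt0.
Qed.

Definition trails_connected s :=
  forall x, x \in trail_verts s -> connect (joined (trail_arrows s)) r x.

Lemma joined_trail_verts s x y :
  joined (trail_arrows s) x y -> (x \in trail_verts s) && (y \in trail_verts s).
Proof.
case/existsP=> -[b o] /and3P[/= /trail_arrowsP[i [t [i_s ->]]] /eqP <- /eqP <-].
rewrite /step_from /step_to /= (trail_src trails) (trail_tgt trails).
by case: o; apply/andP; split; apply/trail_vertsP; right; exists i; eexists.
Qed.

Lemma arc_walk i a n : walk (P i a) [seq (b, true) | b <- arc i a n] (P i (a + n)).
Proof.
elim: n a => [|n IHn] a; first by rewrite addn0.
apply: (@walk_cat _ _ (P i a.+1) _ [:: (A i a, true)]); last by rewrite -addSnnS.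
by rewrite /walk /= /step_to /step_from /= (trail_src trails) (trail_tgt trails).
Qed.

(** Suppose that the trail [i] meets the union of [s] in a second vertex and let
    [a + n] be the first position after [a] where it returns to this union.  The
    arc from [a] to [a + n] has no inner vertex in the union, so together with a
    simple path through the union it forms a cycle with arrows of [i] and of
    some trail in [s]. *)
Lemma trail_meets_once s i a b : trails_connected s -> i \notin s ->
  P i a \in trail_verts s -> P i b \in trail_verts s -> a = b %[mod L i].
Proof.
move=> conn_s i_s a_s b_s; apply/eqP/negPn/negP=> a_b.
have ex_n : exists n, [&& 0 < n, n < L i & P i (a + n) \in trail_verts s].
  (* [b + (L i * a - a)] stands for [b - a], which truncation could make 0. *)
  have bE : a + (b + (L i * a - a)) %% L i = b %[mod L i].
    rewrite modnDmr addnCA subnKC; first by rewrite addnC mulnC modnMDl.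
    by rewrite leq_pmull // (L_gt0 i).
  exists ((b + (L i * a - a)) %% L i).
  rewrite -(trail_vert_mod trails) bE (trail_vert_mod trails) b_s ltn_mod L_gt0.
  by rewrite !andbT lt0n; apply: contraNneq a_b => n0; rewrite -bE n0 addn0.
case: (ex_minnP ex_n) => n /and3P[n_gt0 lt_nL n_s] min_n.
have a_n : a != a + n %[mod L i].
  by rewrite -{1}[a]addn0 eqn_modDl mod0n modn_small // eq_sym -lt0n.
have stay x p : x \in trail_verts s -> path (joined (trail_arrows s)) x p ->
    {subset x :: p <= trail_verts s}.
  elim: p x => [|y p IHp] x x_s /=; first by move=> _ z; rewrite inE => /eqP ->.
  case/andP=> /joined_trail_verts/andP[_ y_s] /(IHp _ y_s) sub z.
  by rewrite inE => /predU1P[-> // | /sub].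
have uniq_arc : uniq [seq P i t | t <- iota a n].
  rewrite map_inj_in_uniq ?iota_uniq // => t u.
  rewrite !mem_iota => /andP[a_t t_n] /andP[a_u u_n] /trail_vert_inj.
  rewrite -(subnKC a_t) -(subnKC a_u) => /eqP; rewrite eqn_modDl.
  rewrite !modn_small ?ltn_subLR ?(leq_trans t_n) ?(leq_trans u_n) //;
    rewrite ?leq_add2l ?(ltnW lt_nL) //.
  by move=> /eqP ->.
have: connect (joined (trail_arrows s)) (P i (a + n)) (P i a).
  apply: connect_trans (conn_s _ a_s).
  by rewrite (sym_connect_sym (@joined_sym _ _)) conn_s.
case/connectP=> p0 /shortenP[p path_p uniq_p _] last_p.
have [s2 [walk2 from2 arr2 uniq2]] := steps_of_path path_p uniq_p.
pose s1 : seq (step Q) := [seq (b, true) | b <- arc i a n].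
have fst1 : map fst s1 = arc i a n by rewrite -map_comp map_id.
have from1 : map (@step_from Q) s1 = [seq P i t | t <- iota a n].
  by rewrite -src_arc -map_comp.
have s2_n0 : s2 != [::].
  apply: contraNneq a_n => s2_nil; move: walk2; rewrite s2_nil -last_p => -[eq_an].
  by apply/eqP/trail_vert_inj.
have cyc : underlying_cycle [set b in map fst (s1 ++ s2)].
  apply: underlying_cycle_of_steps.
  - by rewrite -size_eq0 size_cat addn_eq0 negb_and !size_eq0 s2_n0 orbT.
  - apply: (@closed_walk_cycle _ (P i a)); apply: walk_cat (arc_walk i a n) _.
    by rewrite last_p.
  - rewrite map_cat cat_uniq from1 from2; apply/and3P; split.
    + exact: uniq_arc.
    + apply/hasPn=> x x_p; apply/negP=> /mapP[t]; rewrite mem_iota => t_n xE.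
      have t_s : P i t \in trail_verts s.
        by rewrite -xE; apply: (stay _ _ n_s path_p); apply: mem_belast.
      have xa : x = P i a.
        rewrite xE; congr P; apply/eqP; rewrite eqn_leq.
        apply/andP; split; last by case/andP: t_n.
        rewrite leqNgt; apply/negP=> lt_at.
        have lt_tn : t - a < n by rewrite ltn_subLR ?(ltnW lt_at) //; case/andP: t_n.
        have := min_n (t - a); rewrite subn_gt0 lt_at (ltn_trans lt_tn lt_nL).
        by rewrite subnKC ?(ltnW lt_at) // t_s leqNgt lt_tn => /(_ isT).
      by move: uniq_p; rewrite lastI rcons_uniq -last_p -xa x_p.
    by move: uniq_p; rewrite lastI rcons_uniq => /andP[].
  rewrite map_cat cat_uniq fst1 uniq2 andbT; apply/andP; split.
    by apply: (map_uniq (f := @src Q)); rewrite src_arc.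
  apply/hasPn=> e /arr2 /trail_arrowsP[j [t [j_s ->]]]; apply/negP.
  by case/mem_arcP=> u _ /(trail_arrow_inj trails)[ji _]; rewrite -ji j_s in i_s.
case: s2 s2_n0 arr2 cyc {walk2 from2 uniq2} => // d s2 _ arr2 cyc.
have [|j [t [j_s d_jt]]] := trail_arrowsP _ _ (arr2 d.1 _).
  by rewrite mem_head.
have ij : i = j.
  apply: (underlying_cycle_single_trail (s := a) (t := t) cyc).
    rewrite inE map_cat mem_cat fst1 map_f // mem_iota leqnn -[X in X < _]addn0.
    by rewrite ltn_add2l.
  by rewrite -d_jt inE map_cat mem_cat mem_head orbT.
by rewrite ij j_s in i_s.
Qed.

(** If no further trail met the vertices reached so far, these would be closed
    under adjacency and thus be all vertices, which every trail meets. *)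
Lemma trail_order : connected_digraph Q -> forall n, n <= m -> exists s,
  [/\ size s = n, uniq s, trails_connected s
    & forall i, i \in s -> exists t0, forall t,
        P i t \in trail_verts (take (index i s) s) <-> t = t0 %[mod L i]].
Proof.
move=> [_ connQ]; elim=> [|n IHn] lt_nm.
  by exists [::]; split=> // x /trail_vertsP[-> | [i [t []]]] //; apply: connect0.
have [s [size_s uniq_s conn_s att_s]] := IHn (ltnW lt_nm).
have [i i_s [t0 t0_s]] : exists2 i, i \notin s & exists t, P i t \in trail_verts s.
  have [/'exists_existsP[i [t /andP[i_s t_s]]]|/existsPn none] :=
      boolP [exists i, exists t : 'I_(L i),
               (i \notin s) && (P i t \in trail_verts s)].
    by exists i => //; exists t.
  have fresh i t : P i t \in trail_verts s -> i \in s.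
    move=> t_s; apply/negPn/negP=> i_s; case/negP: (none i).
    apply/existsP; exists (Ordinal (ltn_pmod t (L_gt0 i))) => /=.
    by rewrite i_s (trail_vert_mod trails).
  have all_s x : x \in trail_verts s.
    case/connectP: (connQ r x) => p; elim/last_ind: p x => [|p y IHp] x /=.
      by move=> _ ->; rewrite inE eqxx.
    rewrite rcons_path last_rcons => /andP[/IHp/(_ erefl)]; set z := last r p.
    move=> z_s adj ->.
    have [b eq_b] : exists b,
        (src b == z) && (tgt b == y) || (src b == y) && (tgt b == z).
      by case/orP: adj => /set0Pn[b]; rewrite inE => eq_b; exists b;
        rewrite eq_b ?orbT.
    have [i [t bE]] := trail_arrow_onto trails b.
    move: eq_b; rewrite bE (trail_src trails) (trail_tgt trails).
    case/orP=> /andP[/eqP zE /eqP yE]; rewrite -?zE -?yE in z_s *;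
      by apply/trail_vertsP; right; exists i; eexists; split; [exact: fresh z_s|].
  have [i i_s] : exists i, i \notin s.
    apply/existsP; apply: contraTT lt_nm; rewrite negb_exists => /forallP all_i.
    rewrite -leqNgt -size_s -(card_uniqP uniq_s) -[X in X <= _](card_ord m).
    by apply/subset_leq_card/subsetP=> i _; have := all_i i; rewrite negbK.
  by exists i => //; exists 0.
exists (rcons s i); split.
- by rewrite size_rcons size_s.
- by rewrite rcons_uniq i_s.
- have sub x y : connect (joined (trail_arrows s)) x y ->
      connect (joined (trail_arrows (rcons s i))) x y.
    apply: connect_sub => {}x {}y /existsP[d /and3P[dU dx dy]].
    apply/connect1/existsP; exists d; rewrite dx dy !andbT.
    move: dU; rewrite !inE has_rcons => ->; exact: orbT.
  have reach_t0 : connect (joined (trail_arrows (rcons s i))) r (P i t0).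
    exact/sub/conn_s.
  have reach_i t : connect (joined (trail_arrows (rcons s i))) r (P i (t0 + t)).
    elim: t => [|t IHt]; first by rewrite addn0.
    apply: connect_trans IHt _; apply/connect1/existsP.
    exists (A i (t0 + t), true).
    rewrite /step_from /step_to /= addnS (trail_src trails) (trail_tgt trails).
    rewrite !eqxx !andbT.
    by apply/trail_arrowsP; exists i; eexists; rewrite mem_rcons mem_head.
  move=> x /trail_vertsP[-> | [j [t [j_s ->]]]]; first exact: connect0.
  move: j_s; rewrite mem_rcons inE => /predU1P[-> | j_s].
    have -> : P i t = P i (t0 + (t + (L i * t0 - t0))).
      rewrite -(trail_vert_mod trails i (t0 + _)) addnCA subnKC ?leq_pmull //.
      by rewrite addnC mulnC modnMDl (trail_vert_mod trails).
    exact: reach_i.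
  by apply/sub/conn_s/trail_vertsP; right; exists j, t.
move=> j; rewrite mem_rcons inE => /predU1P[-> | j_s].
  exists t0 => t; rewrite -cats1 index_cat (negPf i_s) /= eqxx addn0.
  rewrite take_size_cat //.
  split=> [t_s|eq_t]; first exact: trail_meets_once t_s t0_s.
  by rewrite -(trail_vert_mod trails) eq_t (trail_vert_mod trails).
have [tj tjP] := att_s j j_s; exists tj => t.
by rewrite -cats1 index_cat j_s takel_cat ?index_size.
Qed.

(** The rank is the position in the list of [trail_order]; [att i] is the
    position at which the trail [i] meets [r] and the trails of lower rank. *)
Lemma trail_attachment : connected_digraph Q -> exists att rk : 'I_m -> nat,
  injective rk /\ forall i t,
    (P i t = r \/ exists j u, rk j < rk i /\ P i t = P j u) <->
    t = att i %[mod L i].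
Proof.
move=> connQ; have [s [size_s uniq_s _ att_s]] := trail_order connQ (leqnn m).
have all_s i : i \in s.
  have /subset_leqif_card[_] : s \subset 'I_m by apply/subsetP.
  rewrite (card_uniqP uniq_s) size_s card_ord eqxx.
  by move/esym/subsetP; apply.
have [att attP] := fin_all_exists (fun i => att_s i (all_s i)).
exists att, (index^~ s); split.
  by move=> i j eq_ij; rewrite -(nth_index i (all_s i)) eq_ij nth_index.
have mem_take i j : (j \in take (index i s) s) = (index j s < index i s).
  exact: in_take.
move=> i t; rewrite -attP; split=> [[-> | [j [u [lt_ji ->]]]] | ].
- by rewrite inE eqxx.
- by apply/trail_vertsP; right; exists j, u; rewrite mem_take.
case/trail_vertsP=> [-> | [j [u [j_i ->]]]]; first by left.
by right; exists j, u; rewrite -mem_take.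
Qed.
End TrailFamily.

(** * The vertical chains of a rooted tree of cycles *)

Section RootedTrails.
Variables (Q : digraph) (m : nat) (L : 'I_m -> nat).
Variables (P : 'I_m -> nat -> vert Q) (A : 'I_m -> nat -> arrow Q).
Variables (r : vert Q) (rk : 'I_m -> nat).
Hypothesis trails : trail_family L P A.
Hypothesis vert_inj : forall i s t, P i s = P i t -> s = t %[mod L i].
Hypothesis parallel_eq : forall a b : arrow Q,
  src a = src b -> tgt a = tgt b -> a = b.
Hypothesis rk_inj : injective rk.
Hypothesis attached : forall i t,
  (P i t = r \/ exists j u, rk j < rk i /\ P i t = P j u) <-> t = 0 %[mod L i].

Let L_gt0 i : 0 < L i. Proof. exact: leq_trans (trail_gt2 trails i). Qed.

Definition chain_size (c : 'I_m.+1) : nat :=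
  if unlift ord0 c is Some i then (L i).-1 else 1.

(** Vertical arrows lower the level whereas arrows of a trail raise the
    position, so levels count the positions backwards from [(L i).-1]; the
    attaching position 0 is left out. *)
Definition chain_vert (c : 'I_m.+1) (l : nat) : vert Q :=
  if unlift ord0 c is Some i then P i (L i - l.+1) else r.

Definition chain_rank (c : 'I_m.+1) : nat :=
  if unlift ord0 c is Some i then (rk i).+1 else 0.

Lemma chain_sizeE i : chain_size (lift ord0 i) = (L i).-1.
Proof. by rewrite /chain_size liftK. Qed.

Lemma chain_vertE i l : chain_vert (lift ord0 i) l = P i (L i - l.+1).
Proof. by rewrite /chain_vert liftK. Qed.

Lemma chain_rankE i : chain_rank (lift ord0 i) = (rk i).+1.
Proof. by rewrite /chain_rank liftK. Qed.

Lemma chain_vert_root l : chain_vert ord0 l = r.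
Proof. by rewrite /chain_vert unlift_none. Qed.

Lemma chain_size_gt0 c : 0 < chain_size c.
Proof.
case: (unliftP ord0 c) => [i|] ->; last by rewrite /chain_size unlift_none.
by rewrite chain_sizeE; have := trail_gt2 trails i; lia.
Qed.

Lemma chain_size_gt1 c : c != ord0 -> 1 < chain_size c.
Proof.
case: (unliftP ord0 c) => [i|] -> // _.
by rewrite chain_sizeE; have := trail_gt2 trails i; lia.
Qed.

Lemma chain_root_level l : l < chain_size ord0 -> l = 0.
Proof. by rewrite /chain_size unlift_none; case: l. Qed.

Lemma inner_not_attached i t : 0 < t < L i ->
  ~ (P i t = r \/ exists j u, rk j < rk i /\ P i t = P j u).
Proof. by case/andP=> t_gt0 t_L /attached; rewrite mod0n modn_small //; lia. Qed.

(** Of two distinct trails sharing a vertex, one has higher rank, and the vertex is the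
    attaching vertex of that trail; so inner positions determine the trail. *)
Lemma inner_eq i s j t : 0 < s < L i -> 0 < t < L j -> P i s = P j t ->
  i = j /\ s = t.
Proof.
move=> s_in t_in eq_st.
have [lt_ij|lt_ji|/rk_inj ij] := ltngtP (rk i) (rk j).
- by case: (inner_not_attached t_in); right; exists i, s.
- by case: (inner_not_attached s_in); right; exists j, t.
split=> //; move: eq_st; rewrite -ij => /vert_inj.
by rewrite -ij in t_in; case/andP: s_in t_in => _ ? /andP[_ ?]; rewrite !modn_small.
Qed.

Lemma chain_vert_inj c x d y : x < chain_size c -> y < chain_size d ->
  chain_vert c x = chain_vert d y -> c = d /\ x = y.
Proof.
case: (unliftP ord0 c) => [i|] ->; case: (unliftP ord0 d) => [j|] ->;
  rewrite ?chain_sizeE ?chain_vertE ?chain_vert_root.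
- move=> x_i y_j /inner_eq[||ij]; try lia.
  by rewrite -ij in y_j *; split=> //; lia.
- move=> x_i _ eq_r; case: (@inner_not_attached i (L i - x.+1)); [lia|by left].
- move=> _ y_j /esym eq_r; case: (@inner_not_attached j (L j - y.+1)); [lia|by left].
by move=> /chain_root_level -> /chain_root_level ->.
Qed.

Lemma chain_vert_inner i t : 0 < t < L i ->
  L i - t.+1 < chain_size (lift ord0 i) /\
  chain_vert (lift ord0 i) (L i - t.+1) = P i t.
Proof.
by move=> t_in; rewrite chain_sizeE chain_vertE; split; [lia | congr P; lia].
Qed.

(** A vertex at position 0 of a trail is [r] or lies on a trail of lower rank;
    descend until it is [r] or an inner vertex.  Only an inner vertex may need
    the chain of the trail [i] itself, whose rank is [(rk i).+1]. *)
Lemma chain_vert_onto_rank i t : exists c l,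
  [/\ l < chain_size c, chain_vert c l = P i t
    & chain_rank c <= rk i + (0 < t %% L i)].
Proof.
have [n] := ubnP (rk i); elim: n i t => // n IHn i t lt_n.
rewrite -(trail_vert_mod trails); have [t0|t_gt0] := posnP (t %% L i); last first.
  have inner_t : 0 < t %% L i < L i by rewrite t_gt0 ltn_mod L_gt0.
  have [lt_k eq_P] := chain_vert_inner inner_t.
  by exists (lift ord0 i), (L i - (t %% L i).+1); rewrite chain_rankE addn1.
have [_ /(_ _)] := attached i (t %% L i).
case=> [||[j [u [lt_ji ->]]]]; first by rewrite t0 mod0n.
  move=> ->; exists ord0, 0; rewrite chain_vert_root chain_size_gt0.
  by split=> //; rewrite /chain_rank unlift_none.
have [c [l [lt_l eq_l le_c]]] := IHn j u (leq_trans lt_ji lt_n).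
exists c, l; split=> //; rewrite addn0 (leq_trans le_c) //.
by case: (0 < _); lia.
Qed.

Lemma parent_chains : exists cl : 'I_m.+1 -> 'I_m.+1 * nat, forall i,
  let: (c, l) := cl (lift ord0 i) in
  [/\ l < chain_size c, chain_vert c l = P i 0 & chain_rank c <= rk i].
Proof.
have ex_cl (d : 'I_m.+1) : exists cl : 'I_m.+1 * nat,
    forall i, d = lift ord0 i ->
    [/\ cl.2 < chain_size cl.1, chain_vert cl.1 cl.2 = P i 0
      & chain_rank cl.1 <= rk i].
  case: (unliftP ord0 d) => [i|] ->; last by exists (ord0, 0) => i /eqP.
  have [c [l]] := chain_vert_onto_rank i 0; rewrite mod0n addn0 => c_l.
  by exists (c, l) => j /lift_inj <-.
have [cl clP] := fin_all_exists ex_cl.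
by exists cl => i; have := clP _ i erefl; case: (cl _).
Qed.

Definition chain_labelling (d : {c : 'I_m.+1 & 'I_(chain_size c)}) : vert Q :=
  chain_vert (tag d) (tagged d).

Lemma chain_labelling_bij : bijective chain_labelling.
Proof.
have inj : injective chain_labelling.
  move=> [c x] [d y] /chain_vert_inj[] //= cd; case: d / cd y => y eq_xy.
  by congr existT; apply: val_inj.
apply: (inj_card_bij inj); rewrite -(card_codom inj).
apply/subset_leq_card/subsetP=> x _; have [i [t ->]] := trail_vert_onto trails x.
have [c [l [lt_l <- _]]] := chain_vert_onto_rank i t.
by apply/codomP; exists (existT _ c (Ordinal lt_l)).
Qed.

(** The arrow at position 0 of a trail comes from the parent chain, the last one
    returns to it, and the others go down the chain of the trail. *)
Lemma arrow_chain_arrow (par : 'I_m.+1 -> 'I_m.+1) (lev : 'I_m.+1 -> nat) c x d y :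
  (forall i, lev (lift ord0 i) < chain_size (par (lift ord0 i)) /\
     chain_vert (par (lift ord0 i)) (lev (lift ord0 i)) = P i 0) ->
  x < chain_size c -> y < chain_size d ->
  (exists b, src b = chain_vert c x /\ tgt b = chain_vert d y) <->
  chain_arrow chain_size ord0 par lev c x d y.
Proof.
move=> parP x_c y_d; split=> [[b []] | ].
  have [i [t ->]] := trail_arrow_onto trails b.
  rewrite -(trail_arrow_mod trails) (trail_src trails) (trail_tgt trails).
  have := ltn_pmod t (L_gt0 i); move: (t %% L i) => {}t t_L src_t tgt_t.
  have [lev_i eq_i] := parP i; have L_gt2 := trail_gt2 trails i.
  rewrite /chain_arrow; have [t0|t_gt0] := posnP t.
    have [lt1 eq1] := @chain_vert_inner i 1 (ltnW L_gt2).
    rewrite t0 -eq1 in tgt_t; rewrite t0 -eq_i in src_t.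
    have [<- <-] := chain_vert_inj lev_i x_c src_t.
    have [<- <-] := chain_vert_inj lt1 y_d tgt_t.
    by rewrite !eqxx chain_sizeE subn2 eqxx orbT.
  have [lt1 eq1] := @chain_vert_inner i t (introT andP (conj t_gt0 t_L)).
  rewrite -eq1 in src_t; have [<- <-] := chain_vert_inj lt1 x_c src_t.
  have [t1_L|t1_L] := ltnP t.+1 (L i).
    have [lt2 eq2] := @chain_vert_inner i t.+1 t1_L.
    rewrite -eq2 in tgt_t; have [<- <-] := chain_vert_inj lt2 y_d tgt_t.
    by rewrite eqxx (subnSK t1_L) eqxx.
  have t1E : t.+1 = L i by apply/eqP; rewrite eqn_leq t_L.
  rewrite t1E -[L i]add0n (trail_vertDl trails) -eq_i in tgt_t.
  have [<- <-] := chain_vert_inj lev_i y_d tgt_t.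
  by rewrite t1E subnn !eqxx !orbT.
case/or3P=> [/andP[/eqP cd /eqP xE] | /and4P[d_root /eqP -> /eqP -> /eqP ->]
            | /and4P[c_root /eqP -> /eqP -> /eqP ->]].
- move: x_c; rewrite -{d y_d}cd {x}xE.
  case: (unliftP ord0 c) => [i|] ->; last by move/chain_root_level.
  rewrite chain_sizeE !chain_vertE => y_L; exists (A i (L i - y.+2)).
  rewrite (trail_src trails) (trail_tgt trails) subnSK //.
  by rewrite (leq_trans y_L) ?leq_pred.
- case: (unliftP ord0 d) d_root => [i|] -> // _; have [_ ->] := parP i.
  exists (A i 0); rewrite (trail_src trails) (trail_tgt trails) chain_vertE chain_sizeE.
  by split=> //; congr P; have := trail_gt2 trails i; lia.
case: (unliftP ord0 c) c_root => [i|] -> // _; have [_ ->] := parP i.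
exists (A i (L i - 1)); rewrite (trail_src trails) (trail_tgt trails) chain_vertE.
by rewrite subnSK // subn0 -[L i]add0n (trail_vertDl trails).
Qed.

Lemma rooted_trails_QN_labelling : QN_labelling chain_labelling.
Proof.
have [cl clP] := parent_chains.
pose par c := (cl c).1; pose lev c := (cl c).2.
have {}clP i : [/\ lev (lift ord0 i) < chain_size (par (lift ord0 i)),
    chain_vert (par (lift ord0 i)) (lev (lift ord0 i)) = P i 0
  & chain_rank (par (lift ord0 i)) <= rk i].
  by have := clP i; rewrite /lev /par; case: (cl _).
have parP i : lev (lift ord0 i) < chain_size (par (lift ord0 i)) /\
    chain_vert (par (lift ord0 i)) (lev (lift ord0 i)) = P i 0.
  by have [] := clP i.
apply: (@chain_tree_QN_labelling _ _ _ _ ord0 par lev chain_rank).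
- exact: chain_size_gt0.
- move=> c; case: (unliftP ord0 c) => [i|] -> // _.
  by have [_ _] := clP i; rewrite chain_rankE.
- by move=> c; case: (unliftP ord0 c) => [i|] -> // _; have [] := clP i.
- exact: chain_size_gt1.
- move=> c x d y; have arrowE := arrow_chain_arrow parP (ltn_ord x) (ltn_ord y).
  rewrite /narrows; set B := arrows_between _ _.
  have memB b :
      reflect (src b = chain_vert c x /\ tgt b = chain_vert d y) (b \in B).
    by rewrite inE; apply: (iffP andP) => -[/eqP ? /eqP ?].
  case: (boolP (chain_arrow _ _ _ _ _ _ _ _)) =>
    [/arrowE[b /[dup] /memB bB [src_b tgt_b]] | no_arrow].
    rewrite (_ : B = [set b]) ?cards1 //; apply/setP=> e; rewrite [RHS]inE.
    apply/idP/eqP=> [/memB[src_e tgt_e]|-> //].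
    by apply: parallel_eq; rewrite ?src_e ?tgt_e.
  apply/eqP; rewrite cards_eq0; apply: contraNT no_arrow => /set0Pn[b /memB bB].
  by apply/arrowE; exists b.
exact: chain_labelling_bij.
Qed.
End RootedTrails.

Theorem proposition4p3 (Q : digraph) :
  tree_of_oriented_cycles Q -> exists2 N : nat, 1 <= N & QN_quiver Q N.
Proof.
case=> quivQ [_ [m [len [len_gt2 glued _ count_cycles]]]].
have [P [A trails]] := trail_family_of_gluing len_gt2 glued.
have connQ : connected_digraph Q by case: quivQ.
have [r _] : exists r : vert Q, r \in vert Q by apply/card_gt0P; case: connQ.
have [att [rk [rk_inj attP]]] := trail_attachment trails count_cycles r connQ.
exists m.+1 => //; split=> //.
exists (chain_size len).
exists (chain_labelling (L := len) (fun i t => P i (att i + t)) r).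
apply: (@rooted_trails_QN_labelling _ _ _ _ _ r rk
          (trail_family_rotate att trails)) => //.
- move=> i s t /(trail_vert_inj trails count_cycles)/eqP.
  by rewrite eqn_modDl => /eqP.
- exact: (trail_parallel_eq trails count_cycles).
move=> i t; have unrot j u : exists w, P j u = P j (att j + w).
  exists (u + (len j * att j - att j)).
  rewrite addnCA subnKC ?leq_pmull ?(leq_trans _ (len_gt2 j)) //.
  rewrite -(trail_vert_mod trails j (u + _)) addnC mulnC modnMDl.
  by rewrite (trail_vert_mod trails).
split=> [[eq_r | [j [u [lt_ji eq_P]]]] | eq_t].
- have /eqP : att i + t = att i %[mod len i] by apply/attP; left.
  by rewrite -{2}[att i]addn0 eqn_modDl => /eqP.
- have /eqP : att i + t = att i %[mod len i].
    by apply/attP; right; exists j, (att j + u).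
  by rewrite -{2}[att i]addn0 eqn_modDl => /eqP.
have : att i + t = att i %[mod len i].
  by apply/eqP; rewrite -{2}[att i]addn0 eqn_modDl eq_t.
case/attP=> [-> | [j [u [lt_ji ->]]]]; first by left.
by right; have [w ->] := unrot j u; exists j, w.
Qed.
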